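(* Every formula provable in Int2GC+FS is Kripke-valid, i.e. valid in every Int2GC+FS-frame.
   Context: Formulas are built from a countably infinite set $\mathrm{Var}$ of propositional variables with the connectives $\neg,\vee,\wedge,\to$ and four unary connectives $\blacktriangle,\blacktriangledown,\vartriangle,\triangledown$. The logic Int2GC is the smallest set of formulas (called provable formulas) that contains intuitionistic propositional logic (in this language) and is closed under substitution, modus ponens, and the four rules: from $A\to\triangledown B$ infer $\blacktriangle A\to B$; from $\blacktriangle A\to B$ infer $A\to\triangledown B$; from $A\to\blacktriangledown B$ infer $\vartriangle A\to B$; from $\vartriangle A\to B$ infer $A\to\blacktriangledown B$. The logic Int2GC+FS is the smallest set of formulas closed under the same rules that contains Int2GC and all instances of (FS1) $\blacktriangle(A\to B)\to(\blacktriangledown A\to\blacktriangle B)$, (FS2) $\vartriangle(A\to B)\to(\triangledown A\to\vartriangle B)$, (FS3) $(\blacktriangle A\to\blacktriangledown B)\to\blacktriangledown(A\to B)$, (FS4) $(\vartriangle A\to\triangledown B)\to\triangledown(A\to B)$. For binary relations, $x\,(R\circ S)\,y$ means that there is $z$ with $x\,R\,z$ and $z\,S\,y$; $\ge$ is the inverse of $\le$. An Int2GC+FS-frame is a triple $(X,\le,R)$ where $X$ is a non-empty set, $\le$ is a preorder on $X$, and $R$ is a binary relation on $X$ with $(R\circ{\le})\subseteq({\le}\circ R)$ and $({\ge}\circ R)\subseteq(R\circ{\ge})$. A valuation on the frame is a map $v\colon\mathrm{Var}\to\wp(X)$ such that $x\in v(p)$ and $x\le y$ imply $y\in v(p)$;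 a frame with a valuation is a model. Satisfaction in a model is defined by: $x\models p$ iff $x\in v(p)$; $x\models A\wedge B$ iff $x\models A$ and $x\models B$; $x\models A\vee B$ iff $x\models A$ or $x\models B$; $x\models A\to B$ iff for all $y\ge x$, $y\models A$ implies $y\models B$; $x\models\neg A$ iff for no $y\ge x$ does $y\models A$; $x\models\blacktriangle A$ iff there is $y$ with $x\,(R\circ{\ge})\,y$ and $y\models A$; $x\models\triangledown A$ iff for all $y$, $y\,(R\circ{\ge})\,x$ implies $y\models A$; $x\models\vartriangle A$ iff there is $y$ with $y\,({\le}\circ R)\,x$ and $y\models A$; $x\models\blacktriangledown A$ iff for all $y$, $x\,({\le}\circ R)\,y$ implies $y\models A$. A formula is valid in a frame if it is satisfied at every point of every model based on the frame. *)

(* Defs.v *)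
From Stdlib Require Import Relations.

Definition var := nat.

Inductive formula : Set :=
| FVar (p : var)
| FNeg (A : formula)
| FOr (A B : formula)
| FAnd (A B : formula)
| FImp (A B : formula)
| FBlackUp (A : formula)
| FBlackDown (A : formula)
| FWhiteUp (A : formula)
| FWhiteDown (A : formula).

Declare Scope form_scope.
Delimit Scope form_scope with form.
Bind Scope form_scope with formula.
Notation "¬ A" := (FNeg A) (at level 40, A at level 40) : form_scope.
Notation "▲ A" := (FBlackUp A) (at level 40, A at level 40) : form_scope.
Notation "▼ A" := (FBlackDown A) (at level 40, A at level 40) : form_scope.
Notation "△ A" := (FWhiteUp A) (at level 40, A at level 40) : form_scope.
Notation "▽ A" := (FWhiteDown A) (at level 40, A at level 40) : form_scope.
Notation "A ∧ B" := (FAnd A B) (at level 45, right associativity) : form_scope.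
Notation "A ∨ B" := (FOr A B) (at level 46, right associativity) : form_scope.
Notation "A ⊃ B" := (FImp A B) (at level 47, right associativity) : form_scope.
Local Open Scope form_scope.

Fixpoint subst (s : var -> formula) (A : formula) : formula :=
  match A with
  | FVar p => s p
  | ¬ A => ¬ subst s A
  | A ∨ B => subst s A ∨ subst s B
  | A ∧ B => subst s A ∧ subst s B
  | A ⊃ B => subst s A ⊃ subst s B
  | ▲ A => ▲ subst s A
  | ▼ A => ▼ subst s A
  | △ A => △ subst s A
  | ▽ A => ▽ subst s A
  end.

(* Hilbert-style axiomatization of intuitionistic propositional logic with
   primitive negation; the metavariables range over the full modal language. *)
Inductive IPL : formula -> Prop :=
| IPL_K A B : IPL (A ⊃ B ⊃ A)
| IPL_S A B C : IPL ((A ⊃ B ⊃ C) ⊃ (A ⊃ B) ⊃ A ⊃ C)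
| IPL_andI A B : IPL (A ⊃ B ⊃ A ∧ B)
| IPL_andE1 A B : IPL (A ∧ B ⊃ A)
| IPL_andE2 A B : IPL (A ∧ B ⊃ B)
| IPL_orI1 A B : IPL (A ⊃ A ∨ B)
| IPL_orI2 A B : IPL (B ⊃ A ∨ B)
| IPL_orE A B C : IPL ((A ⊃ C) ⊃ (B ⊃ C) ⊃ A ∨ B ⊃ C)
| IPL_negI A B : IPL ((A ⊃ B) ⊃ (A ⊃ ¬ B) ⊃ ¬ A)
| IPL_negE A B : IPL (¬ A ⊃ A ⊃ B)
| IPL_mp A B : IPL (A ⊃ B) -> IPL A -> IPL B.

Inductive Int2GC : formula -> Prop :=
| Int2GC_IPL A : IPL A -> Int2GC A
| Int2GC_subst s A : Int2GC A -> Int2GC (subst s A)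
| Int2GC_mp A B : Int2GC (A ⊃ B) -> Int2GC A -> Int2GC B
| Int2GC_GC1 A B : Int2GC (A ⊃ ▽ B) -> Int2GC (▲ A ⊃ B)
| Int2GC_GC2 A B : Int2GC (▲ A ⊃ B) -> Int2GC (A ⊃ ▽ B)
| Int2GC_GC3 A B : Int2GC (A ⊃ ▼ B) -> Int2GC (△ A ⊃ B)
| Int2GC_GC4 A B : Int2GC (△ A ⊃ B) -> Int2GC (A ⊃ ▼ B).

Inductive Int2GCFS : formula -> Prop :=
| Int2GCFS_Int2GC A : Int2GC A -> Int2GCFS A
| Int2GCFS_FS1 A B : Int2GCFS (▲ (A ⊃ B) ⊃ ▼ A ⊃ ▲ B)
| Int2GCFS_FS2 A B : Int2GCFS (△ (A ⊃ B) ⊃ ▽ A ⊃ △ B)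
| Int2GCFS_FS3 A B : Int2GCFS ((▲ A ⊃ ▼ B) ⊃ ▼ (A ⊃ B))
| Int2GCFS_FS4 A B : Int2GCFS ((△ A ⊃ ▽ B) ⊃ ▽ (A ⊃ B))
| Int2GCFS_subst s A : Int2GCFS A -> Int2GCFS (subst s A)
| Int2GCFS_mp A B : Int2GCFS (A ⊃ B) -> Int2GCFS A -> Int2GCFS B
| Int2GCFS_GC1 A B : Int2GCFS (A ⊃ ▽ B) -> Int2GCFS (▲ A ⊃ B)
| Int2GCFS_GC2 A B : Int2GCFS (▲ A ⊃ B) -> Int2GCFS (A ⊃ ▽ B)
| Int2GCFS_GC3 A B : Int2GCFS (A ⊃ ▼ B) -> Int2GCFS (△ A ⊃ B)
| Int2GCFS_GC4 A B : Int2GCFS (△ A ⊃ B) -> Int2GCFS (A ⊃ ▼ B).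

Definition rcomp {X : Type} (R S : relation X) : relation X :=
  fun x y => exists z, R x z /\ S z y.

Record frame : Type := Frame {
  world : Type;
  le : relation world;
  acc : relation world;
  world_nonempty : inhabited world;
  le_preorder : preorder world le;
  acc_le : inclusion world (rcomp acc le) (rcomp le acc);
  ge_acc : inclusion world (rcomp (transp world le) acc)
                           (rcomp acc (transp world le))
}.
Arguments le {f} _ _.
Arguments acc {f} _ _.
Definition ge {F : frame} : relation (world F) := transp (world F) le.

Record valuation (F : frame) : Type := Valuation {
  val : var -> world F -> Prop;
  val_persistent : forall p x y, val p x -> le x y -> val p y
}.
Arguments val {F} _ _ _.

Fixpoint sat {F : frame} (v : valuation F) (x : world F) (A : formula) : Prop :=
  match A with
  | FVar p => val v p x
  | A ∧ B => sat v x A /\ sat v x B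
  | A ∨ B => sat v x A \/ sat v x B
  | A ⊃ B => forall y, le x y -> sat v y A -> sat v y B
  | ¬ A => ~ exists y, le x y /\ sat v y A
  | ▲ A => exists y, rcomp acc ge x y /\ sat v y A
  | ▽ A => forall y, rcomp acc ge y x -> sat v y A
  | △ A => exists y, rcomp le acc y x /\ sat v y A
  | ▼ A => forall y, rcomp le acc x y -> sat v y A
  end.

Definition valid_in (F : frame) (A : formula) : Prop :=
  forall (v : valuation F) (x : world F), sat v x A.

Definition Kripke_valid (A : formula) : Prop :=
  forall F : frame, valid_in F A.

(* Main.v *)
(* A preorder-persistent satisfaction relation makes intuitionistic logic sound,
   and the Galois rules hold because ▲, ▽ quantify over the converse directions
   of the same relation [R ∘ ≥], and △, ▼ over those of [≤ ∘ R]. The two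
   interaction conditions on [≤] and [R] give persistence of ▲ and △; in the
   axioms (FS1)-(FS4) they move an [R]-edge along [≤] so that premise and
   conclusion are evaluated at a common world. *)

From Stdlib Require Import Relations.
Require Import Defs.

Local Open Scope form_scope.

Section Frames.
Context {F : frame}.
Implicit Types x y z : world F.

Lemma le_refl x : le x x.
Proof. apply (preord_refl _ _ (le_preorder F)). Qed.

Lemma le_trans x y z : le x y -> le y z -> le x z.
Proof. apply (preord_trans _ _ (le_preorder F)). Qed.

Lemma acc_le_swap x y z : acc x y -> le y z -> exists w, le x w /\ acc w z.
Proof. intros Hxy Hyz; apply (acc_le F); exists y; split; assumption. Qed.

Lemma acc_up x y z : le x y -> acc x z -> exists w, acc y w /\ le z w.
Proof.
  intros Hxy Hxz; apply (ge_acc F); exists x; split; assumption.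
Qed.

End Frames.

Local Hint Resolve le_refl le_trans : core.

(** ▼ and ▽ persist by transitivity: [≤ ∘ R] absorbs a further [≤] at its source, [R ∘ ≥] a further
    [≥] at its target. For ▲ and △ the old witness survives, as the frame conditions reconnect it to
    the larger world. *)
Lemma sat_persistent (F : frame) (v : valuation F) (A : formula) (x y : world F) :
  le x y -> sat v x A -> sat v y A.
Proof.
  revert x y.
  induction A as [p|A IH|A IHA B IHB|A IHA B IHB|A IHA B IHB|A IH|A IH|A IH|A IH];
    simpl; intros x y Hxy Hx.
  - eapply val_persistent; eauto.
  - intros (z & Hyz & Hz); apply Hx; eauto.
  - destruct Hx; eauto.
  - destruct Hx; eauto.
  - eauto.
  - destruct Hx as (w & (z & Hxz & Hzw) & Hw).
    destruct (acc_up _ _ _ Hxy Hxz) as (u & Hyu & Hzu).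
    exists w; split; [exists u; split|]; auto.
    exact (le_trans _ _ _ Hzw Hzu).
  - intros w (z & Hyz & Hzw); apply Hx.
    exists z; split; eauto.
  - destruct Hx as (w & (z & Hwz & Hzx) & Hw).
    destruct (acc_le_swap _ _ _ Hzx Hxy) as (u & Hzu & Huy).
    exists w; split; [exists u; split|]; eauto.
  - intros w (z & Hwz & Hyz); apply Hx.
    exists z; split; auto.
    exact (le_trans _ _ _ Hxy Hyz).
Qed.

(** Turns substitution into a change of valuation on the same frame; persistence of every formula
    [s p] makes it a legitimate valuation. *)
Definition subst_valuation {F : frame} (s : var -> formula) (v : valuation F) :
    valuation F :=
  Valuation F (fun p x => sat v x (s p))
    (fun p x y Hx Hxy => sat_persistent F v (s p) x y Hxy Hx).

Lemma sat_subst (F : frame) (v : valuation F) (s : var -> formula) (A : formula) :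
  forall x, sat v x (subst s A) <-> sat (subst_valuation s v) x A.
Proof.
  induction A; simpl; intros x; firstorder.
Qed.

Lemma Kripke_valid_subst (s : var -> formula) (A : formula) :
  Kripke_valid A -> Kripke_valid (subst s A).
Proof. intros H F v x; apply sat_subst, H. Qed.

Lemma Kripke_valid_mp (A B : formula) :
  Kripke_valid (A ⊃ B) -> Kripke_valid A -> Kripke_valid B.
Proof. intros HAB HA F v x; apply (HAB F v x x); [auto | apply HA]. Qed.

(** By reflexivity, both validities amount to the same condition: if [z (R ∘ ≥) y] and [A] holds at
    [y], then [B] holds at [z]. *)
Lemma Kripke_valid_blackup_whitedown (A B : formula) :
  Kripke_valid (▲ A ⊃ B) <-> Kripke_valid (A ⊃ ▽ B).
Proof.
  split; intros H F v x y _; simpl.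
  - intros HA z Hzy; apply (H F v z z); [auto | exists y; auto].
  - intros (z & Hyz & HA); apply (H F v z z); auto.
Qed.

Lemma Kripke_valid_whiteup_blackdown (A B : formula) :
  Kripke_valid (△ A ⊃ B) <-> Kripke_valid (A ⊃ ▼ B).
Proof.
  split; intros H F v x y _; simpl.
  - intros HA z Hyz; apply (H F v z z); [auto | exists y; auto].
  - intros (z & Hzy & HA); apply (H F v z z); auto.
Qed.

Lemma IPL_sound (A : formula) : IPL A -> Kripke_valid A.
Proof.
  induction 1; [..| eapply Kripke_valid_mp; eassumption];
    intros F v x; simpl.
  - intros y _ HA z Hyz _; eapply sat_persistent; eauto.
  - intros y _ HABC z Hyz HAB u Hzu HA; apply (HABC u); eauto.
  - intros y _ HA z Hyz HB; split; [eapply sat_persistent|]; eauto.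
  - tauto.
  - tauto.
  - tauto.
  - tauto.
  - intros y _ HAC z Hyz HBC u Hzu [HA|HB]; eauto.
  - intros y _ HAB z Hyz HAnB (u & Hzu & HA).
    apply (HAnB u Hzu HA); exists u; eauto.
  - intros y _ HnA z Hyz HA; destruct HnA; eauto.
Qed.

Lemma Int2GC_sound (A : formula) : Int2GC A -> Kripke_valid A.
Proof.
  induction 1.
  - apply IPL_sound; assumption.
  - apply Kripke_valid_subst; assumption.
  - eapply Kripke_valid_mp; eassumption.
  - apply Kripke_valid_blackup_whitedown; assumption.
  - apply Kripke_valid_blackup_whitedown; assumption.
  - apply Kripke_valid_whiteup_blackdown; assumption.
  - apply Kripke_valid_whiteup_blackdown; assumption.
Qed.

Lemma Kripke_valid_FS1 (A B : formula) : Kripke_valid (▲ (A ⊃ B) ⊃ ▼ A ⊃ ▲ B).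
Proof.
  intros F v x0 x _ (w & (z & Hxz & Hwz) & HAB) y Hxy HA.
  (* The common world is [u]: [w ≤ z ≤ u] brings in [A ⊃ B], while [y R u] brings in [A] and makes
     [u] a witness for [▲ B] at [y]. *)
  destruct (acc_up _ _ _ Hxy Hxz) as (u & Hyu & Hzu).
  exists u; split; [exists u; split; [assumption | apply le_refl]|].
  apply HAB; [exact (le_trans _ _ _ Hwz Hzu)|].
  apply HA; exists y; auto.
Qed.

Lemma Kripke_valid_FS2 (A B : formula) : Kripke_valid (△ (A ⊃ B) ⊃ ▽ A ⊃ △ B).
Proof.
  intros F v x0 x _ (w & (z & Hwz & Hzx) & HAB) y Hxy HA.
  (* Here [u] lies above [w], hence inherits [A ⊃ B], and [u R y] lets [▽ A] at [y] supply [A]. *)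
  destruct (acc_le_swap _ _ _ Hzx Hxy) as (u & Hzu & Huy).
  exists u; split; [exists u; auto|].
  apply HAB; [eauto|].
  apply HA; exists y; split; [assumption | apply le_refl].
Qed.

Lemma Kripke_valid_FS3 (A B : formula) : Kripke_valid ((▲ A ⊃ ▼ B) ⊃ ▼ (A ⊃ B)).
Proof.
  intros F v x0 x _ HAB y (z & Hxz & Hzy) y' Hyy' HA.
  (* The world [w] is above [x] and sees [y'], so [A] at [y'] gives [▲ A] at [w]; then [▼ B] at [w]
     returns [B] to [y']. *)
  destruct (acc_le_swap _ _ _ Hzy Hyy') as (w & Hzw & Hwy').
  apply (HAB w); [eauto | | exists w; auto].
  exists y'; split; [|assumption].
  exists y'; split; [assumption | apply le_refl].
Qed.

Lemma Kripke_valid_FS4 (A B : formula) : Kripke_valid ((△ A ⊃ ▽ B) ⊃ ▽ (A ⊃ B)).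
Proof.
  intros F v x0 x _ HAB y (z & Hyz & Hxz) y' Hyy' HA.
  (* Now [u] is above [x] and is seen from [y'], so [△ A] holds at [u], and [▽ B] at [u] yields [B]
     at [y']. *)
  destruct (acc_up _ _ _ Hyy' Hyz) as (u & Hy'u & Hzu).
  apply (HAB u); [exact (le_trans _ _ _ Hxz Hzu) | |].
  - exists y'; split; [exists y'; auto | assumption].
  - exists u; split; [assumption | apply le_refl].
Qed.

Theorem theorem4p10 : forall A : formula, Int2GCFS A -> Kripke_valid A.
Proof.
  induction 1.
  - apply Int2GC_sound; assumption.
  - apply Kripke_valid_FS1.
  - apply Kripke_valid_FS2.
  - apply Kripke_valid_FS3.
  - apply Kripke_valid_FS4.
  - apply Kripke_valid_subst; assumption.
  - eapply Kripke_valid_mp; eassumption.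
  - apply Kripke_valid_blackup_whitedown; assumption.
  - apply Kripke_valid_blackup_whitedown; assumption.
  - apply Kripke_valid_whiteup_blackdown; assumption.
  - apply Kripke_valid_whiteup_blackdown; assumption.
Qed.
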